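(* Let $\kappa>0$, let $K\subset\mathbb{R}^2$ be a mesh element with $K\subset B(x_K,h_K)$, and let $z,w\in\mathbb{C}$ with $|\operatorname{Im}z|,|\operatorname{Im}w|\le\eta_{\max}$. Define $$D_\eta=\sqrt{\cosh(2\eta_{\max})},\qquad E_K=e^{\kappa h_K\sinh\eta_{\max}}.$$ Then $$\|\psi_z^K-\psi_w^K\|_{H^1(K)}\le C_{H^1,K}|z-w|,\qquad \|\psi_z^K-\psi_w^K\|_{\mathrm{tr},K}\le C_{\mathrm{tr},K}|z-w|,\qquad \|\psi_z^K-\psi_w^K\|_{\partial K,+}\le C_{\partial,K}|z-w|,$$ where one may take $$C_{H^1,K}=|K|^{1/2}\kappa D_\eta E_K\big(h_K^2+(1+\kappa h_KD_\eta)^2\big)^{1/2},$$ $$C_{\mathrm{tr},K}=\Big(2\pi h_K\,\kappa D_\eta^2E_K^2\big[(\kappa h_K)^2+(1+\kappa h_KD_\eta)^2\big]\Big)^{1/2},$$ $$C_{\partial,K}=\Big(|\partial K|\,\kappa D_\eta^2E_K^2\big[(\kappa h_K)^2+(1+\kappa h_KD_\eta)^2\big]\Big)^{1/2}.$$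
   Context: For $z\in\mathbb{C}$, $\psi_z^K(x)=e^{i\kappa d(z)\cdot(x-x_K)}$ with $d(z)=(\cos z,\sin z)\in\mathbb{C}^2$ and the bilinear dot product. $\|v\|_{H^1(K)}^2=\|v\|_{L^2(K)}^2+\|\nabla v\|_{L^2(K)}^2$. The trace norm is taken on the circle bounding the disk $B(x_K,h_K)$: $$\|v\|_{\mathrm{tr},K}^2=\int_{\partial B(x_K,h_K)}\big(\kappa|v|^2+\kappa^{-1}|\partial_nv|^2\big)\,ds,$$ with $\partial_n$ the outward normal derivative, and the augmented element-boundary norm is $$\|v\|_{\partial K,+}^2=\int_{\partial K}\big(\kappa|v|^2+\kappa^{-1}|\nabla v|^2\big)\,ds .$$ $|K|$ is the area of $K$ and $|\partial K|$ the length of its boundary (elements are bounded Lipschitz domains with piecewise smooth boundary). *)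

(* Defs.v *)
From HB Require Import structures.
From mathcomp Require Import all_boot all_order all_algebra.
From mathcomp Require Import complex.
From mathcomp Require Import all_classical all_reals all_analysis.

Set Implicit Arguments.
Unset Strict Implicit.
Unset Printing Implicit Defensive.

Import Order.TTheory GRing.Theory Num.Theory.
Import numFieldNormedType.Exports.

Local Open Scope classical_set_scope.
Local Open Scope ring_scope.
Local Open Scope complex_scope.

Section ComplexFunctions.
Variable R : realType.
Implicit Types (x : R) (z : R[i]).

Definition sinh x : R := (expR x - expR (- x)) / 2.
Definition cosh x : R := (expR x + expR (- x)) / 2.

(* The norm [`|z|] of the library is an element of [R[i]]; this one is in [R]. *)
Definition cabs z : R := ComplexField.Normc.normc z.

Definition cexp z : R[i] :=
  (expR (complex.Re z) * cos (complex.Im z))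
    +i* (expR (complex.Re z) * sin (complex.Im z)).
Definition ccos z : R[i] := (cexp ('i%C * z) + cexp (- ('i%C * z))) / 2.
Definition csin z : R[i] := (cexp ('i%C * z) - cexp (- ('i%C * z))) / (2 * 'i%C).

End ComplexFunctions.

Section Plane.
Variable R : realType.
Implicit Types (x y c n : R * R) (p q : R[i] * R[i]) (v : R * R -> R[i]).

(* The norm and the balls of the library on [R * R] are those of the sup norm,
   hence these Euclidean ones. *)
Definition enorm x : R := Num.sqrt (x.1 ^+ 2 + x.2 ^+ 2).
Definition eball c (h : R) : set (R * R) := [set x | enorm (x - c) < h].

Definition toC2 x : R[i] * R[i] := (x.1%:C, x.2%:C).

(* The bilinear product: no conjugation. *)
Definition dotC p q : R[i] := p.1 * q.1 + p.2 * q.2.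

Definition cnorm2 p : R := Num.sqrt (cabs p.1 ^+ 2 + cabs p.2 ^+ 2).

Definition dirC (z : R[i]) : R[i] * R[i] := (ccos z, csin z).

Definition psi (kappa : R) c (z : R[i]) : R * R -> R[i] :=
  fun x => cexp ('i%C * kappa%:C * dotC (dirC z) (toC2 (x - c))).

(* Derivative in the direction [n] of a complex-valued function on the plane,
   taken on real and imaginary parts. *)
Definition dderiv n v x : R[i] :=
  ('D_n (fun y => complex.Re (v y)) x) +i* ('D_n (fun y => complex.Im (v y)) x).

Definition grad v x : R[i] * R[i] := (dderiv (1, 0) v x, dderiv (0, 1) v x).

Definition normal_deriv n v x : R[i] := dotC (grad v x) (toC2 n).

Definition bdry (K : set (R * R)) : set (R * R) := closure K `\` interior K.

End Plane.

Section MeshElement.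
Variable R : realType.

(* Near [p], in some rotated orthonormal frame centred at [p], [K] is the set
   of points lying below the graph of a Lipschitz function. *)
Definition lipschitz_chart (K : set (R * R)) (p : R * R) : Prop :=
  exists (e : R * R) (r s : R) (phi : R -> R),
    [/\ enorm e = 1, 0 < r, 0 < s, [lipschitz phi a | a in [set: R]] &
        forall a b : R, `|a| < r -> `|b| < s ->
          (K (p + a *: e + b *: (- e.2, e.1)) <-> b < phi a)].

Definition bounded_lipschitz_domain (K : set (R * R)) : Prop :=
  [/\ K !=set0, open K, connected K, bounded_set K &
      forall p, bdry K p -> lipschitz_chart K p].

Definition C1 (f : R -> R) : Prop :=
  (forall t, derivable f t 1) /\ continuous (derive1 f).

Definition velocity (gamma : R -> R * R) (t : R) : R * R :=
  (derive1 (fun s => (gamma s).1) t, derive1 (fun s => (gamma s).2) t).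

(* An arc is the restriction to [0, 1] of [gamma]. A map that is C^1 on [0, 1]
   up to the end points extends to a C^1 map on the line, so that asking for
   regularity on the whole line is no restriction. *)
Definition regular_arc (gamma : R -> R * R) : Prop :=
  [/\ C1 (fun t => (gamma t).1), C1 (fun t => (gamma t).2) &
      forall t : R, t \in `[0, 1] -> velocity gamma t != 0].

(* The boundary is the union of finitely many regular arcs that are simple and
   meet each other only at end points; an arc may be closed. *)
Definition piecewise_smooth_boundary (K : set (R * R)) (n : nat)
    (arc : 'I_n -> R -> R * R) : Prop :=
  [/\ forall j, regular_arc (arc j),
      bdry K = \bigcup_j (arc j @` `[0, 1]) &
      forall j k (s t : R), s \in `[0, 1] -> t \in `[0, 1] -> arc j s = arc k t ->
        (j = k /\ s = t) \/
        ((s = 0 \/ s = 1) /\ (t = 0 \/ t = 1))].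

Record mesh_element := MeshElement {
  element :> set (R * R);
  arc_count : nat;
  boundary_arc : 'I_arc_count -> R -> R * R;
  element_lipschitz : bounded_lipschitz_domain element;
  element_boundary : piecewise_smooth_boundary element boundary_arc }.

Definition arc_integral (gamma : R -> R * R) (a b : R) (f : R * R -> R) :
    \bar R :=
  (\int[lebesgue_measure]_(t in `[a, b])
     (f (gamma t) * enorm (velocity gamma t))%:E)%E.

Definition boundary_integral (K : mesh_element) (f : R * R -> R) : \bar R :=
  (\sum_(j < arc_count K) arc_integral (boundary_arc j) 0 1 f)%E.

Definition circle_integral (c : R * R) (h : R) (f : R * R -> R) : \bar R :=
  arc_integral (fun t => (c.1 + h * cos t, c.2 + h * sin t)) 0 (2 * pi) f.

Definition area_integral (K : set (R * R)) (f : R * R -> R) : \bar R :=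
  (\int[(lebesgue_measure \x lebesgue_measure)]_(x in K) (f x)%:E)%E.

(* Elements are bounded, and their arcs are C^1 on [0, 1]: both numbers below
   are finite before [fine] is applied. *)
Definition area (K : mesh_element) : R :=
  fine ((lebesgue_measure \x lebesgue_measure)%E (K : set (R * R))).
Definition perimeter (K : mesh_element) : R :=
  fine (boundary_integral K (fun=> 1)).

End MeshElement.

Section Norms.
Variable R : realType.
Implicit Types (K : mesh_element R) (v : R * R -> R[i]).

Definition H1_norm K v : \bar R :=
  sqrte (area_integral K (fun x => cabs (v x) ^+ 2)%R +
         area_integral K (fun x => cnorm2 (grad v x) ^+ 2)%R)%E.

(* [h^-1 *: (x - c)] is the outward unit normal at [x]. *)
Definition trace_norm (kappa : R) (c : R * R) (h : R) v : \bar R :=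
  sqrte (circle_integral c h (fun x =>
    kappa * cabs (v x) ^+ 2 +
    kappa^-1 * cabs (normal_deriv (h^-1 *: (x - c)) v x) ^+ 2)).

Definition boundary_norm (kappa : R) K v : \bar R :=
  sqrte (boundary_integral K (fun x =>
    kappa * cabs (v x) ^+ 2 + kappa^-1 * cnorm2 (grad v x) ^+ 2)).

End Norms.

(* Main.v *)
Require Import Defs.
From HB Require Import structures.
From mathcomp Require Import all_boot all_order all_algebra.
From mathcomp Require Import complex.
From mathcomp Require Import all_classical all_reals all_analysis.
From mathcomp Require Import ring lra.

Set Implicit Arguments.
Unset Strict Implicit.
Unset Printing Implicit Defensive.

Import Order.TTheory GRing.Theory Num.Theory.
Import numFieldNormedType.Exports.

Local Open Scope classical_set_scope.
Local Open Scope ring_scope.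
Local Open Scope complex_scope.

(** For fixed [x], the map taking [z] to [psi kappa c z x] is entire, and the
    three bounds come from estimating its derivative, and that of its gradient
    in [x], along the segment from [w] to [z].

    Write [d = dirC] and [y = x - c].  Then [psi = exp (i kappa d(z).y)], its
    [x]-gradient is [i kappa psi d(z)], and differentiating in [z] gives
    [i kappa (d'(z).y) psi] and
    [i kappa psi (d'(z) + i kappa (d'(z).y) d(z))].
    With [z = a + i b], the vectors [d(z)] and [d'(z)] have the same Hermitian
    norm, of square [cosh (2 b)], hence at most [D] on the strip
    [|Im z| <= etamax]; and the imaginary part of [d(z)] is [sinh b] times the
    unit vector [(- sin a, cos a)], so that [|psi| <= E] when [|y| <= hK].
    The strip is convex and thus contains the segment, which yields, at each
    point of the closed disk of radius [hK], the bounds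
    [kappa hK D E |z - w|] for the difference of the two waves ([psiB_le]) and
    [kappa D E (1 + kappa hK D) |z - w|] for its gradient ([grad_psiB_le]).
    The mean value step is [cpair_mean_value_le].

    What remains is to integrate constants over the element, the circle and the
    arcs of the boundary ([area_integral_le], [circle_integral_le],
    [boundary_integral_le]).  The only points that need care are that the area
    and the perimeter are finite, so that their real values are the true ones,
    that the element is measurable for the product sigma-algebra, and that the
    boundary of the element lies in the closed disk. *)

(** * Derivatives of complex-valued functions of a real variable *)

Section ComplexDerivative.
Variable R : realType.
Implicit Types (t : R) (F G : R -> R[i]).

(** Componentwise, to match [dderiv]. *)
Definition is_cderive t F (dF : R[i]) : Prop :=
  is_derive t 1 (fun s => complex.Re (F s)) (complex.Re dF) /\
  is_derive t 1 (fun s => complex.Im (F s)) (complex.Im dF).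

Lemma is_cderive_cst (a : R[i]) t : is_cderive t (fun=> a) 0.
Proof. by split; exact: is_derive_cst. Qed.

Lemma is_cderive_real t : is_cderive t (fun s => s%:C) 1.
Proof. by split; [exact: is_derive_id|exact: is_derive_cst]. Qed.

Lemma is_cderiveD F G dF dG t : is_cderive t F dF -> is_cderive t G dG ->
  is_cderive t (fun s => F s + G s) (dF + dG).
Proof.
move=> [F1 F2] [G1 G2]; split.
- have -> : (fun s => complex.Re (F s + G s)) =
    (fun s => complex.Re (F s)) + (fun s => complex.Re (G s)).
    by apply/funext => s; rewrite !fctE; case: (F s) (G s) => ? ? [].
  by case: dF dG F1 G1 {F2 G2} => ? ? [? ?] /= ? ?; exact: is_deriveD.
- have -> : (fun s => complex.Im (F s + G s)) =
    (fun s => complex.Im (F s)) + (fun s => complex.Im (G s)).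
    by apply/funext => s; rewrite !fctE; case: (F s) (G s) => ? ? [].
  by case: dF dG F2 G2 {F1 G1} => ? ? [? ?] /= ? ?; exact: is_deriveD.
Qed.

Lemma is_cderiveM F G dF dG t : is_cderive t F dF -> is_cderive t G dG ->
  is_cderive t (fun s => F s * G s) (dF * G t + F t * dG).
Proof.
move=> [F1 F2] [G1 G2]; split.
- have -> : (fun s => complex.Re (F s * G s)) =
    (fun s => complex.Re (F s)) * (fun s => complex.Re (G s)) -
    (fun s => complex.Im (F s)) * (fun s => complex.Im (G s)).
    by apply/funext => s; rewrite !fctE; case: (F s) (G s) => ? ? [].
  have H := is_deriveB (is_deriveM F1 G1) (is_deriveM F2 G2).
  apply: (is_derive_eq H); rewrite /GRing.scale/=.
  by case: dF dG (F t) (G t) {F1 F2 G1 G2 H} => ? ? [? ?] [? ?] [? ?] /=; ring.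
- have -> : (fun s => complex.Im (F s * G s)) =
    (fun s => complex.Re (F s)) * (fun s => complex.Im (G s)) +
    (fun s => complex.Im (F s)) * (fun s => complex.Re (G s)).
    by apply/funext => s; rewrite !fctE; case: (F s) (G s) => ? ? [].
  have H := is_deriveD (is_deriveM F1 G2) (is_deriveM F2 G1).
  apply: (is_derive_eq H); rewrite /GRing.scale/=.
  by case: dF dG (F t) (G t) {F1 F2 G1 G2 H} => ? ? [? ?] [? ?] [? ?] /=; ring.
Qed.

Lemma is_cderiveMl (a : R[i]) F dF t : is_cderive t F dF ->
  is_cderive t (fun s => a * F s) (a * dF).
Proof.
by move=> /(is_cderiveM (is_cderive_cst a t)); rewrite mul0r add0r.
Qed.

Lemma is_cderiveN F dF t : is_cderive t F dF ->
  is_cderive t (fun s => - F s) (- dF).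
Proof.
move=> /(is_cderiveMl (-1)); rewrite mulN1r.
by under [fun s => -1 * F s]funext do rewrite mulN1r.
Qed.

Lemma is_cderiveB F G dF dG t : is_cderive t F dF -> is_cderive t G dG ->
  is_cderive t (fun s => F s - G s) (dF - dG).
Proof. by move=> dFt /is_cderiveN; exact: is_cderiveD. Qed.

Lemma is_cderive_affine (a b : R[i]) t : is_cderive t (fun s => a + s%:C * b) b.
Proof.
have := is_cderiveD (is_cderive_cst a t)
  (is_cderiveM (is_cderive_real t) (is_cderive_cst b t)).
by rewrite mulr0 addr0 mul1r add0r.
Qed.

Lemma is_cderive_cexp F dF t : is_cderive t F dF ->
  is_cderive t (fun s => cexp (F s)) (cexp (F t) * dF).
Proof.
move=> [F1 F2].
have dexp := is_derive1_comp (is_derive_expR _) F1.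
have dcos := is_derive1_comp (is_derive_cos _) F2.
have dsin := is_derive1_comp (is_derive_sin _) F2.
split => /=.
- apply: (is_derive_eq (is_deriveM dexp dcos)); rewrite /GRing.scale/=.
  by case: dF {F1 F2 dexp dcos dsin} => ? ? /=; ring.
- apply: (is_derive_eq (is_deriveM dexp dsin)); rewrite /GRing.scale/=.
  by case: dF {F1 F2 dexp dcos dsin} => ? ? /=; ring.
Qed.

Lemma complexi_neq0 : 'i%C != 0 :> R[i].
Proof. by rewrite eq_complex /= oner_eq0 andbF. Qed.

Lemma inv2iE : (2 * 'i%C)^-1 = - 'i%C / 2 :> R[i].
Proof.
have n0 : 2 * 'i%C != 0 :> R[i] by rewrite mulf_neq0 ?pnatr_eq0 ?complexi_neq0.
apply: (mulIf n0); rewrite mulVf// mulrA divfK ?pnatr_eq0// mulNr.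
by rewrite -expr2 sqr_i opprK.
Qed.

Lemma is_cderive_ccos F dF t : is_cderive t F dF ->
  is_cderive t (fun s => ccos (F s)) (- csin (F t) * dF).
Proof.
move=> dFt; have dp := is_cderive_cexp (is_cderiveMl 'i%C dFt).
have dm := is_cderive_cexp (is_cderiveN (is_cderiveMl 'i%C dFt)).
have := is_cderiveM (is_cderiveD dp dm) (is_cderive_cst (2^-1) t).
congr is_cderive; rewrite /csin.
rewrite inv2iE; by ring.
Qed.

Lemma is_cderive_csin F dF t : is_cderive t F dF ->
  is_cderive t (fun s => csin (F s)) (ccos (F t) * dF).
Proof.
move=> dFt; have dp := is_cderive_cexp (is_cderiveMl 'i%C dFt).
have dm := is_cderive_cexp (is_cderiveN (is_cderiveMl 'i%C dFt)).
have := is_cderiveM (is_cderiveB dp dm) (is_cderive_cst ((2 * 'i%C)^-1) t).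
congr is_cderive; rewrite /ccos.
by field; exact: complexi_neq0.
Qed.

(** A directional derivative is an ordinary derivative along a line; this is how
    all spatial gradients below are computed. *)
Lemma dderivE n (v : R * R -> R[i]) x dv :
  is_cderive 0 (fun s => v (s *: n + x)) dv -> dderiv n v x = dv.
Proof.
move=> [[_ d1] [_ d2]]; rewrite /dderiv; case: dv d1 d2 => a b /= <- <-.
by congr Complex; rewrite /derive; congr (lim (_ @ 0^')); apply/funext => h /=;
  rewrite addr0 scale0r add0r /GRing.scale/= mulr1.
Qed.

End ComplexDerivative.

(** * Norms of pairs of complex numbers *)

Section ComplexNorms.
Variable R : realType.
Implicit Types (a : R[i]) (p q : R[i] * R[i]) (y : R * R).

Lemma cabs_ge0 a : 0 <= cabs a.
Proof. by case: a => ? ?; exact: sqrtr_ge0. Qed.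

Lemma cnorm2_ge0 p : 0 <= cnorm2 p.
Proof. exact: sqrtr_ge0. Qed.

Lemma cabs_sqrE a : cabs a ^+ 2 = complex.Re a ^+ 2 + complex.Im a ^+ 2.
Proof. by case: a => x y; rewrite sqr_sqrtr ?addr_ge0 ?sqr_ge0. Qed.

Lemma cabsM a b : cabs (a * b) = cabs a * cabs b.
Proof. exact: ComplexField.Normc.normcM. Qed.

Lemma cabsN a : cabs (- a) = cabs a.
Proof. exact: normcN. Qed.

Lemma cabs_real (r : R) : 0 <= r -> cabs r%:C = r.
Proof.
by move=> r0; rewrite /cabs/= expr0n addr0 sqrtr_sqr ger0_norm.
Qed.

Lemma cabsi : cabs ('i%C : R[i]) = 1.
Proof. by rewrite /cabs/= expr0n add0r expr1n sqrtr1. Qed.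

Lemma cnorm2_sqrE p : cnorm2 p ^+ 2 = cabs p.1 ^+ 2 + cabs p.2 ^+ 2.
Proof. by rewrite sqr_sqrtr ?addr_ge0 ?sqr_ge0. Qed.

Lemma enorm_sqrE y : enorm y ^+ 2 = y.1 ^+ 2 + y.2 ^+ 2.
Proof. by rewrite sqr_sqrtr ?addr_ge0 ?sqr_ge0. Qed.

Lemma enorm_ge0 y : 0 <= enorm y.
Proof. exact: sqrtr_ge0. Qed.

Lemma cnorm2_pair0 a : cnorm2 (a, 0) = cabs a.
Proof.
have cabs0 : cabs (0 : R[i]) = 0 by exact: ComplexField.Normc.normc0.
have -> : cnorm2 (a, 0) = Num.sqrt (cabs a ^+ 2 + cabs (0 : R[i]) ^+ 2) by [].
by rewrite cabs0 expr0n addr0 sqrtr_sqr ger0_norm ?cabs_ge0.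
Qed.

Lemma cnorm2M a b1 b2 : cnorm2 (a * b1, a * b2) = cabs a * cnorm2 (b1, b2).
Proof.
apply/eqP; rewrite -(@eqrXn2 _ 2) ?mulr_ge0 ?cnorm2_ge0 ?cabs_ge0//.
by rewrite exprMn !cnorm2_sqrE/= !cabsM !exprMn mulrDr.
Qed.

(** The Hermitian norm of a pair of complex numbers is the Euclidean norm of
    [R^4], whose inner product is this one: the real part of the Hermitian
    product. *)
Definition cinner p q : R :=
  (complex.Re p.1 * complex.Re q.1 + complex.Im p.1 * complex.Im q.1) +
  (complex.Re p.2 * complex.Re q.2 + complex.Im p.2 * complex.Im q.2).

Lemma cinner_le p q : cinner p q <= cnorm2 p * cnorm2 q.
Proof.
apply: le_trans (ler_norm _) _.
rewrite -ler_sqr ?nnegrE ?mulr_ge0 ?cnorm2_ge0//.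
rewrite real_normK ?num_real// exprMn !cnorm2_sqrE !cabs_sqrE /cinner.
move: p q => [[a1 a2] [a3 a4]] [[b1 b2] [b3 b4]] /=; rewrite -subr_ge0.
have -> : (a1 ^+ 2 + a2 ^+ 2 + (a3 ^+ 2 + a4 ^+ 2)) *
    (b1 ^+ 2 + b2 ^+ 2 + (b3 ^+ 2 + b4 ^+ 2)) -
    (a1 * b1 + a2 * b2 + (a3 * b3 + a4 * b4)) ^+ 2 =
    (a1 * b2 - a2 * b1) ^+ 2 + (a1 * b3 - a3 * b1) ^+ 2 +
    (a1 * b4 - a4 * b1) ^+ 2 + (a2 * b3 - a3 * b2) ^+ 2 +
    (a2 * b4 - a4 * b2) ^+ 2 + (a3 * b4 - a4 * b3) ^+ 2 by ring.
by rewrite !addr_ge0 ?sqr_ge0.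
Qed.

Lemma cnorm2D_sqrE p q : cnorm2 (p.1 + q.1, p.2 + q.2) ^+ 2 =
  cnorm2 p ^+ 2 + cnorm2 q ^+ 2 + cinner p q *+ 2.
Proof.
rewrite !cnorm2_sqrE !cabs_sqrE /cinner.
by move: p q => [[? ?] [? ?]] [[? ?] [? ?]] /=; ring.
Qed.

Lemma cnorm2D p q : cnorm2 (p.1 + q.1, p.2 + q.2) <= cnorm2 p + cnorm2 q.
Proof.
rewrite -ler_sqr ?nnegrE ?addr_ge0 ?cnorm2_ge0//.
rewrite cnorm2D_sqrE sqrrD addrAC lerD2r lerD2l lerMn2r//; exact: cinner_le.
Qed.

Lemma CauchySchwarz2 (a b c d : R) :
  (a * c + b * d) ^+ 2 <= (a ^+ 2 + b ^+ 2) * (c ^+ 2 + d ^+ 2).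
Proof.
rewrite -subr_ge0 (_ : _ - _ = (a * d - b * c) ^+ 2) ?sqr_ge0//.
by ring.
Qed.

Lemma cabs_dotC p y : cabs (dotC p (toC2 y)) <= cnorm2 p * enorm y.
Proof.
rewrite -ler_sqr ?nnegrE ?mulr_ge0 ?enorm_ge0 ?cabs_ge0 ?cnorm2_ge0//.
rewrite exprMn cnorm2_sqrE enorm_sqrE !cabs_sqrE.
move: p y => [[a1 b1] [a2 b2]] [y1 y2] /=.
have := CauchySchwarz2 a1 a2 y1 y2; have := CauchySchwarz2 b1 b2 y1 y2.
by lra.
Qed.

Lemma cabs_cexp a : cabs (cexp a) = expR (complex.Re a).
Proof.
apply/eqP; rewrite -(@eqrXn2 _ 2) ?cabs_ge0 ?expR_ge0//.
by rewrite cabs_sqrE/= !exprMn -mulrDr cos2Dsin2 mulr1.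
Qed.

(** No mean value equality holds for vector-valued functions; instead, the real
    theorem is applied to the inner product with the total increment [c], which
    grows by the square of the norm of [c] from [0] to [1], while its derivative
    is at most [M] times that norm. *)
Lemma cpair_mean_value_le (G1 G2 : R -> R[i]) (dG1 dG2 : R -> R[i]) (M : R) :
  (forall t, is_cderive t G1 (dG1 t)) -> (forall t, is_cderive t G2 (dG2 t)) ->
  (forall t, 0 <= t <= 1 -> cnorm2 (dG1 t, dG2 t) <= M) ->
  cnorm2 (G1 1 - G1 0, G2 1 - G2 0) <= M.
Proof.
move=> d1 d2 dM; set c := (G1 1 - G1 0, G2 1 - G2 0).
pose g t := cinner c (G1 t, G2 t).
pose dg t := cinner c (dG1 t, dG2 t).
have gd (t : R) : is_derive t (1 : R) g (dg t).
  have [d1r d1i] := d1 t; have [d2r d2i] := d2 t.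
  exact: (is_deriveD
    (is_deriveD (is_deriveZ (complex.Re c.1) d1r) (is_deriveZ (complex.Im c.1) d1i))
    (is_deriveD (is_deriveZ (complex.Re c.2) d2r) (is_deriveZ (complex.Im c.2) d2i))).
have [|t] := @MVT_segment _ g dg 0 1 ler01 (fun t _ => gd t).
  apply: continuous_subspaceT => t.
  by apply: differentiable_continuous; apply/derivable1_diffP; case: (gd t).
rewrite in_itv/= subr0 mulr1 => t01 gE.
have : cnorm2 c ^+ 2 <= cnorm2 c * M.
  have -> : cnorm2 c ^+ 2 = g 1 - g 0.
    rewrite cnorm2_sqrE !cabs_sqrE /g /cinner /c/=.
    by move: (G1 1) (G1 0) (G2 1) (G2 0) => [? ?] [? ?] [? ?] [? ?] /=; ring.
  rewrite gE; apply: le_trans (cinner_le _ _) _.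
  by rewrite ler_wpM2l ?cnorm2_ge0 ?dM.
have [->|c0] := eqVneq (cnorm2 c) 0.
  by move=> _; apply: le_trans (dM t t01); exact: cnorm2_ge0.
by rewrite expr2 ler_pM2l// lt_neqAle eq_sym c0 cnorm2_ge0.
Qed.

End ComplexNorms.

(** * Plane waves with complex direction *)

Section PlaneWave.
Variable R : realType.
Implicit Types (z w : R[i]) (x y c : R * R).

Definition dirC_deriv z : R[i] * R[i] := (- csin z, ccos z).

Lemma sinh_norm_le (b eta : R) : `|b| <= eta -> `|sinh b| <= sinh eta.
Proof.
rewrite ler_norml => /andP[lb ub]; rewrite /sinh ler_norml.
have : expR (- eta) <= expR b by rewrite ler_expR.
have : expR b <= expR eta by rewrite ler_expR.
have : expR (- b) <= expR eta by rewrite ler_expR; lra.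
have : expR (- eta) <= expR (- b) by rewrite ler_expR; lra.
by move=> *; apply/andP; split; lra.
Qed.

Lemma cosh2E (b : R) : cosh (2 * b) = 1 + 2 * sinh b ^+ 2.
Proof.
have bN : expR b * expR (- b) = 1 by rewrite -expRD subrr expR0.
have -> : 2 * b = b + b by ring.
rewrite /cosh /sinh opprD !expRD; lra.
Qed.

Lemma ccosE (a b : R) : ccos (a +i* b) = (cos a * cosh b) -i* (sin a * sinh b).
Proof.
have -> : ccos (a +i* b) = (cexp (- b +i* a) + cexp (b -i* a)) * (2^-1)%:C.
  rewrite /ccos; congr (_ * _); last by rewrite fmorphV rmorph_nat.
  congr (cexp _ + cexp _).
  - by simpc.
  - by simpc.
rewrite /cexp/= cosN sinN /cosh /sinh.
by apply/eqP; rewrite eq_complex/=; apply/andP; split; apply/eqP; field.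
Qed.

Lemma csinE (a b : R) : csin (a +i* b) = (sin a * cosh b) +i* (cos a * sinh b).
Proof.
have -> : csin (a +i* b) =
    (cexp (- b +i* a) - cexp (b -i* a)) * (0 -i* 2^-1).
  rewrite /csin; congr (_ * _); last first.
    rewrite inv2iE -(rmorph_nat (real_complex R)) -fmorphV.
    by apply/eqP; rewrite eq_complex /=; apply/andP; split; apply/eqP; ring.
  congr (cexp _ - cexp _).
  - by simpc.
  - by simpc.
rewrite /cexp/= cosN sinN /cosh /sinh.
by apply/eqP; rewrite eq_complex/=; apply/andP; split; apply/eqP; field.
Qed.

Lemma dirCE (a b : R) : dirC (a +i* b) =
  ((cos a * cosh b) -i* (sin a * sinh b), (sin a * cosh b) +i* (cos a * sinh b)).
Proof. by rewrite /dirC ccosE csinE. Qed.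

Lemma cosh_sinh (b : R) : cosh b ^+ 2 - sinh b ^+ 2 = 1.
Proof.
have bN : expR b * expR (- b) = 1 by rewrite -expRD subrr expR0.
rewrite /cosh /sinh; lra.
Qed.

(** The real and imaginary parts of [dirC (a + i b)] are [cosh b] and [sinh b]
    times two orthogonal unit vectors. *)
Lemma dirC_norm z : cnorm2 (dirC z) ^+ 2 = cosh (2 * complex.Im z).
Proof.
case: z => a b; rewrite cnorm2_sqrE !cabs_sqrE dirCE /= cosh2E.
have := cos2Dsin2 a; have := cosh_sinh b.
set C := cosh b; set S := sinh b => CS cs.
have -> : (cos a * C) ^+ 2 + (- (sin a * S)) ^+ 2 +
  ((sin a * C) ^+ 2 + (cos a * S) ^+ 2) =
  (cos a ^+ 2 + sin a ^+ 2) * (C ^+ 2 + S ^+ 2) by ring.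
by rewrite cs; lra.
Qed.

Lemma dirC_deriv_norm z : cnorm2 (dirC_deriv z) = cnorm2 (dirC z).
Proof.
apply/eqP; rewrite -(@eqrXn2 _ 2) ?cnorm2_ge0//.
by rewrite !cnorm2_sqrE [cabs (dirC_deriv z).1]cabsN addrC.
Qed.

Lemma dirC_le z (eta : R) : `|complex.Im z| <= eta ->
  cnorm2 (dirC z) <= Num.sqrt (cosh (2 * eta)).
Proof.
move=> zeta.
have le_cosh : cosh (2 * complex.Im z) <= cosh (2 * eta).
  rewrite !cosh2E lerD2l ler_pM2l// -[leLHS]real_normK ?num_real//.
  by rewrite lerXn2r ?nnegrE ?sinh_norm_le// (le_trans _ (sinh_norm_le zeta)).
have eta0 : 0 <= cosh (2 * eta).
  by apply: le_trans le_cosh; rewrite -dirC_norm sqr_ge0.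
by rewrite -ler_sqr ?nnegrE ?sqrtr_ge0 ?cnorm2_ge0// dirC_norm sqr_sqrtr.
Qed.

(** The modulus of the wave is the exponential of [- kappa] times the imaginary
    part of [d(z).y], which is [sinh b] times the scalar product of [y] with a
    unit vector. *)
Lemma cabs_psi_le kappa c z x (h eta : R) : 0 <= kappa ->
  enorm (x - c) <= h -> `|complex.Im z| <= eta ->
  cabs (psi kappa c z x) <= expR (kappa * h * sinh eta).
Proof.
move=> k0 xh zeta; rewrite /psi cabs_cexp ler_expR.
have -> : complex.Re ('i%C * kappa%:C * dotC (dirC z) (toC2 (x - c))) =
    - kappa * complex.Im (dotC (dirC z) (toC2 (x - c))).
  by case: (dotC _ _) => ? ? /=; ring.
rewrite -mulrA mulNr -mulrN; apply: ler_wpM2l => //.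
case: z zeta => a b zeta; rewrite dirCE.
move: (x - c) xh => -[y1 y2] xh; rewrite /dotC; simpc => /=.
apply: (@le_trans _ _ (enorm (y1, y2) * `|sinh b|)); last first.
  by rewrite ler_pM ?enorm_ge0 ?sinh_norm_le.
apply: le_trans (ler_norm _) _.
rewrite -ler_sqr ?nnegrE ?mulr_ge0 ?enorm_ge0// exprMn enorm_sqrE /=.
rewrite !real_normK ?num_real//.
have cs := cos2Dsin2 a; have := CauchySchwarz2 (- sin a) (cos a) y1 y2.
rewrite sqrrN [sin a ^+ 2 + _]addrC cs mul1r.
move=> /(ler_wpM2r (sqr_ge0 (sinh b))); apply: le_trans.
by rewrite le_eqVlt; apply/orP; left; apply/eqP; ring.
Qed.

Section Segment.
Variables (z w : R[i]).
Let Z (t : R) : R[i] := w + t%:C * (z - w).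

(** Convexity of the strip. *)
Lemma segment_Im (eta t : R) : `|complex.Im z| <= eta ->
  `|complex.Im w| <= eta -> 0 <= t <= 1 -> `|complex.Im (Z t)| <= eta.
Proof.
have -> : complex.Im (Z t) = (1 - t) * complex.Im w + t * complex.Im z.
  by rewrite /Z; case: z w => ? ? [? ?] /=; ring.
move=> hz hw /andP[t0 t1]; apply: le_trans (ler_normD _ _) _.
rewrite !normrM (ger0_norm t0) ger0_norm ?subr_ge0//.
by nra.
Qed.

Variables (kappa : R) (c : R * R).
Hypothesis kappa0 : 0 <= kappa.

Lemma is_cderive_psi_dir x t :
  is_cderive t (fun s => psi kappa c (Z s) x)
    (psi kappa c (Z t) x *
     ('i%C * kappa%:C * (dotC (dirC_deriv (Z t)) (toC2 (x - c)) * (z - w)))).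
Proof.
apply: is_cderive_cexp; apply: is_cderiveMl; rewrite /dotC /=.
have dZ := is_cderive_affine w (z - w) t.
have := is_cderiveD
  (is_cderiveM (is_cderive_ccos dZ) (is_cderive_cst (x - c).1%:C t))
  (is_cderiveM (is_cderive_csin dZ) (is_cderive_cst (x - c).2%:C t)).
by congr is_cderive; rewrite !mulr0 !addr0; ring.
Qed.

(** Along a line in the plane the phase is affine. *)
Lemma is_cderive_psi_space z' n x :
  is_cderive 0 (fun s => psi kappa c z' (s *: n + x))
    ('i%C * kappa%:C * dotC (dirC z') (toC2 n) * psi kappa c z' x).
Proof.
pose a := 'i%C * kappa%:C * dotC (dirC z') (toC2 (x - c)).
pose b := 'i%C * kappa%:C * dotC (dirC z') (toC2 n).
have E : (fun s => psi kappa c z' (s *: n + x)) = (fun s => cexp (a + s%:C * b)).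
  apply/funext => s; rewrite /psi /a /b; congr cexp; rewrite /dotC /=.
  have lin (u v e : R) : (s * u + v - e)%:C = s%:C * u%:C + (v - e)%:C :> R[i].
    by rewrite -rmorphM -rmorphD addrA.
  by rewrite /GRing.scale /= !lin; ring.
rewrite E; have := is_cderive_cexp (is_cderive_affine a b 0).
congr is_cderive; rewrite (_ : 0%:C = 0)// mul0r addr0 mulrC.
by congr (_ * _).
Qed.

Lemma grad_psiB x : grad (fun y => psi kappa c z y - psi kappa c w y) x =
  ('i%C * kappa%:C * (ccos z * psi kappa c z x - ccos w * psi kappa c w x),
   'i%C * kappa%:C * (csin z * psi kappa c z x - csin w * psi kappa c w x)).
Proof.
rewrite /grad; congr pair.
- rewrite (dderivE (is_cderiveB (is_cderive_psi_space z (1, 0) x)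
    (is_cderive_psi_space w (1, 0) x))) /dotC /= (_ : 1%:C = 1)// (_ : 0%:C = 0)//.
  by ring.
- rewrite (dderivE (is_cderiveB (is_cderive_psi_space z (0, 1) x)
    (is_cderive_psi_space w (0, 1) x))) /dotC /= (_ : 1%:C = 1)// (_ : 0%:C = 0)//.
  by ring.
Qed.

Variables (h eta : R).
Hypotheses (z_eta : `|complex.Im z| <= eta) (w_eta : `|complex.Im w| <= eta).
Let D := Num.sqrt (cosh (2 * eta)).
Let E := expR (kappa * h * sinh eta).

(** The pair with a zero second entry reduces the scalar mean value inequality
    to the one for pairs. *)
Lemma psiB_le x : enorm (x - c) <= h ->
  cabs (psi kappa c z x - psi kappa c w x) <= kappa * h * D * E * cabs (z - w).
Proof.
move=> xh; pose f t := psi kappa c (Z t) x.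
have Z1 : Z 1 = z by rewrite /Z (_ : 1%:C = 1)//; ring.
have Z0 : Z 0 = w by rewrite /Z (_ : 0%:C = 0)//; ring.
rewrite -cnorm2_pair0.
have -> : (psi kappa c z x - psi kappa c w x, 0) = (f 1 - f 0, 0 - 0) :> R[i] * R[i].
  by rewrite /f Z1 Z0 subrr.
apply: (@cpair_mean_value_le _ f (fun=> 0) _ (fun=> 0)).
- exact: is_cderive_psi_dir.
- exact: is_cderive_cst.
- move=> t t01; have Zt := segment_Im z_eta w_eta t01.
  rewrite cnorm2_pair0 !cabsM cabsi (cabs_real kappa0) mul1r.
  have -> : kappa * h * D * E * cabs (z - w) =
    E * (kappa * (D * h * cabs (z - w))) by ring.
  have := cabs_psi_le kappa0 xh Zt; rewrite -/E => psiE.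
  have dD : cnorm2 (dirC_deriv (Z t)) <= D by rewrite dirC_deriv_norm dirC_le.
  have dh : cabs (dotC (dirC_deriv (Z t)) (toC2 (x - c))) <= D * h.
    apply: le_trans (cabs_dotC _ _) _.
    by rewrite ler_pM ?cnorm2_ge0 ?enorm_ge0.
  by rewrite ler_pM ?mulr_ge0 ?cabs_ge0// ler_wpM2l// ler_wpM2r ?cabs_ge0.
Qed.

(** Up to the factor [i kappa], the gradient of a wave is [psi] times
    [dirC], whose derivative along the segment is
    [psi (z - w) (d' + i kappa (d'.y) d)]: the triangle inequality gives the two
    terms [D] and [kappa h D * D]. *)
Lemma grad_psiB_le x : enorm (x - c) <= h ->
  cnorm2 (grad (fun y => psi kappa c z y - psi kappa c w y) x) <=
  kappa * D * E * (1 + kappa * h * D) * cabs (z - w).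
Proof.
move=> xh; pose f t := psi kappa c (Z t) x.
have Z1 : Z 1 = z by rewrite /Z (_ : 1%:C = 1)//; ring.
have Z0 : Z 0 = w by rewrite /Z (_ : 0%:C = 0)//; ring.
rewrite grad_psiB cnorm2M cabsM cabsi (cabs_real kappa0) mul1r.
have -> : kappa * D * E * (1 + kappa * h * D) * cabs (z - w) =
  kappa * (E * cabs (z - w) * (D + kappa * (D * h) * D)) by ring.
apply: ler_wpM2l => //.
pose G1 t := ccos (Z t) * f t; pose G2 t := csin (Z t) * f t.
have -> : (ccos z * psi kappa c z x - ccos w * psi kappa c w x,
    csin z * psi kappa c z x - csin w * psi kappa c w x) =
    (G1 1 - G1 0, G2 1 - G2 0) by rewrite /G1 /G2 /f Z1 Z0.
have dZ t := is_cderive_affine w (z - w) t.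
apply: cpair_mean_value_le => [t|t|t t01].
- exact: (is_cderiveM (is_cderive_ccos (dZ t)) (is_cderive_psi_dir x t)).
- exact: (is_cderiveM (is_cderive_csin (dZ t)) (is_cderive_psi_dir x t)).
have Zt := segment_Im z_eta w_eta t01; rewrite -/(Z t) -/(f t).
set d := dotC (dirC_deriv (Z t)) (toC2 (x - c)).
pose m := 'i%C * kappa%:C * d.
rewrite (_ : (_, _) = ((f t * (z - w)) * (- csin (Z t) + m * ccos (Z t)),
   (f t * (z - w)) * (ccos (Z t) + m * csin (Z t)))); last first.
  by rewrite /m; congr pair; ring.
rewrite cnorm2M cabsM.
have psiE : cabs (f t) <= E by exact: cabs_psi_le.
have D1 : cnorm2 (dirC (Z t)) <= D by exact: dirC_le.
have D2 : cnorm2 (dirC_deriv (Z t)) <= D by rewrite dirC_deriv_norm.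
have dh : cabs m <= kappa * (D * h).
  rewrite !cabsM cabsi (cabs_real kappa0) mul1r ler_wpM2l//.
  by apply: le_trans (cabs_dotC _ _) _; rewrite ler_pM ?cnorm2_ge0 ?enorm_ge0.
rewrite ler_pM ?mulr_ge0 ?cabs_ge0 ?cnorm2_ge0 ?ler_wpM2r ?cabs_ge0//.
apply: le_trans (cnorm2D (dirC_deriv (Z t)) (m * ccos (Z t), m * csin (Z t))) _.
rewrite lerD// cnorm2M.
by rewrite ler_pM ?cabs_ge0 ?cnorm2_ge0.
Qed.

End Segment.
End PlaneWave.

(** * Integrals over the element, the circle and the boundary *)

Section Integration.
Variable R : realType.
Implicit Types (c : R * R).

(** The integral of a nonnegative function is a supremum over the simple
    functions below it, and a larger function has more of them. *)
Lemma ge0_le_integral_nonmeasurable d (T : measurableType d)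
    (mu : {measure set T -> \bar R}) (A : set T) (f g : T -> \bar R) :
  (forall x, A x -> (0 <= f x)%E) -> (forall x, A x -> (f x <= g x)%E) ->
  (\int[mu]_(x in A) f x <= \int[mu]_(x in A) g x)%E.
Proof.
move=> f0 fg; have g0 x : A x -> (0 <= g x)%E.
  by move=> Ax; exact: le_trans (f0 x Ax) (fg x Ax).
rewrite !ge0_integralE//; apply: le_ereal_sup; apply: image_subset => k /= kf x.
apply: le_trans (kf x) _; rewrite /patch; case: ifPn => // xA.
by apply: fg; rewrite inE in xA.
Qed.

(** An open set of the plane is the union of the countably many open rectangles
    with rational sides that it contains. *)
Lemma open_measurable_plane (A : set (R * R)) : open A -> measurable A.
Proof.
move=> oA.
pose S (q : (rat * rat) * (rat * rat)) : set (R * R) :=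
  `](ratr q.1.1), (ratr q.1.2)[%classic `*` `](ratr q.2.1), (ratr q.2.2)[%classic.
have -> : A = \bigcup_q (if `[< S q `<=` A >] then S q else set0).
  apply/seteqP; split => [p Ap|p [q _]]; last by case: asboolP => // + ?; exact.
  move: (oA); rewrite openE => /(_ _ Ap)/nbhs_ballP[e /= e0 eA].
  have lt_l (u : R) : u - e < u by rewrite ltrBlDr ltrDl.
  have lt_r (u : R) : u < u + e by rewrite ltrDl.
  have [[a1 a1p] [b1 b1p]] := (rat_in_itvoo (lt_l p.1), rat_in_itvoo (lt_r p.1)).
  have [[a2 a2p] [b2 b2p]] := (rat_in_itvoo (lt_l p.2), rat_in_itvoo (lt_r p.2)).
  move: a1p b1p a2p b2p; rewrite !in_itv /=.
  move=> /andP[la1 ra1] /andP[lb1 rb1] /andP[la2 ra2] /andP[lb2 rb2].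
  exists ((a1, b1), (a2, b2)) => //; case: asboolP => [_|[]].
    by split; rewrite /= in_itv/=; apply/andP.
  move=> [y1 y2] [/=]; rewrite !in_itv/= => /andP[ly1 ry1] /andP[ly2 ry2].
  by apply: eA; split; rewrite /ball/= ltr_distlC; apply/andP; split; lra.
apply: countable_bigcupT_measurable; first exact: countableP.
move=> q; case: asboolP => _; last exact: measurable0.
by apply: measurableX; exact: measurable_itv.
Qed.

Lemma enorm_continuous c : continuous (fun x : R * R => enorm (x - c)).
Proof.
move=> x; apply: (@cvg_comp _ _ _ _ (@Num.sqrt R)); last exact: sqrt_continuous.
have d1 : (fun x : R * R => (x - c).1) @ x --> (x - c).1.
  by apply: cvgB; [exact: cvg_fst|exact: cvg_cst].
have d2 : (fun x : R * R => (x - c).2) @ x --> (x - c).2.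
  by apply: cvgB; [exact: cvg_snd|exact: cvg_cst].
by apply: cvgD; apply: cvgM.
Qed.

(** The boundary of an element may touch the circle, so the pointwise bounds
    are needed on the closed disk. *)
Lemma closure_eball (K : set (R * R)) c (h : R) :
  K `<=` eball c h -> closure K `<=` [set x | enorm (x - c) <= h].
Proof.
move=> Kh; rewrite (_ : [set x | _] = closure [set x | enorm (x - c) <= h]).
  by apply: closure_subset => x /Kh /ltW.
apply/closure_id; apply: (@closed_comp _ _ (fun x : R * R => enorm (x - c)) [set r | r <= h]).
  by move=> x _; exact: enorm_continuous.
exact: closed_le.
Qed.

Lemma sqrte_le_EFin (X : \bar R) (Y : R) :
  0 <= Y -> (X <= (Y ^+ 2)%:E)%E -> (sqrte X <= Y%:E)%E.
Proof.
move=> Y0 XY; have -> : Y%:E = sqrte (Y ^+ 2)%:E.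
  by rewrite /sqrte sqrtr_sqr ger0_norm.
by rewrite lee_sqrt// lee_fin sqr_ge0.
Qed.

Lemma coord_le_enorm (y : R * R) : `|y.1| <= enorm y /\ `|y.2| <= enorm y.
Proof.
by split; rewrite -sqrtr_sqr /enorm ler_wsqrtr// ?lerDl ?lerDr sqr_ge0.
Qed.

Lemma enormZ (r : R) (y : R * R) : enorm (r *: y) = `|r| * enorm y.
Proof.
rewrite /enorm /= /GRing.scale/= !exprMn -mulrDr sqrtrM ?sqr_ge0//.
by rewrite sqrtr_sqr.
Qed.

Section Area.
Variables (K : set (R * R)) (c : R * R) (h : R).
Hypotheses (oK : open K) (Kh : K `<=` eball c h).
Let mu := (@lebesgue_measure R \x @lebesgue_measure R)%E.

(** The disk lies in a square of side [2 h]. *)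
Lemma measure_fin_num_eball : (mu K \is a fin_num)%E.
Proof.
have mK := open_measurable_plane oK.
rewrite ge0_fin_numE ?measure_ge0//.
pose Q : set (R * R) := `[c.1 - h, c.1 + h]%classic `*` `[c.2 - h, c.2 + h]%classic.
have mQ : measurable Q by apply: measurableX; exact: measurable_itv.
have KQ : K `<=` Q.
  move=> x /Kh /ltW xh; have [x1 x2] := coord_le_enorm (x - c).
  by split; rewrite /= in_itv/= -ler_distlC distrC; apply: le_trans xh.
apply: (@le_lt_trans _ _ (mu Q)); first by apply: le_measure; rewrite ?inE.
have fin_itv (u v : R) : @lebesgue_measure R `[u, v]%classic \is a fin_num.
  by rewrite lebesgue_measure_itv/=; case: ifPn.
rewrite /mu product_measure1E; try exact: measurable_itv.
by rewrite ltey_eq (fin_numM (fin_itv _ _) (fin_itv _ _)).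
Qed.

Lemma area_integral_le (f : R * R -> R) (M : R) : 0 <= M ->
  (forall x, K x -> 0 <= f x <= M) ->
  (area_integral K f <= (M * fine (mu K))%:E)%E.
Proof.
move=> M0 fM; rewrite EFinM fineK ?measure_fin_num_eball//.
rewrite -integral_cst; last exact: open_measurable_plane.
by apply: ge0_le_integral_nonmeasurable => x /fM /andP[f0 fxM]; rewrite lee_fin.
Qed.

End Area.

Section Arc.
Variables (gamma : R -> R * R) (a b : R).
Hypothesis speed_cont : continuous (fun t => enorm (velocity gamma t)).

(* The factor [1] is the integrand of the arc length, as it stands in the
   definition of the perimeter. *)
Let speed1_cont : continuous (fun t => 1 * enorm (velocity gamma t)).
Proof. by under eq_fun do rewrite mul1r. Qed.

Lemma arc_integral1_ge0 : (0 <= arc_integral gamma a b (fun=> 1%R))%E.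
Proof. by apply: integral_ge0 => t _; rewrite lee_fin mul1r enorm_ge0. Qed.

(** The speed is continuous on a compact interval. *)
Lemma arc_integral1_fin : arc_integral gamma a b (fun=> 1%R) \is a fin_num.
Proof.
rewrite ge0_fin_numE ?arc_integral1_ge0//; apply: integrable_lty.
  exact: measurable_itv.
apply: (@continuous_compact_integrable _ (fun t => 1 * enorm (velocity gamma t))).
  exact: segment_compact.
exact: continuous_subspaceT.
Qed.

Lemma arc_integral_le (f : R * R -> R) (M : R) : 0 <= M ->
  (forall t, t \in `[a, b] -> 0 <= f (gamma t) <= M) ->
  (arc_integral gamma a b f <= M%:E * arc_integral gamma a b (fun=> 1%R))%E.
Proof.
move=> M0 fM; rewrite /arc_integral -ge0_integralZl_EFin//.
- apply: ge0_le_integral_nonmeasurable => t /= /fM /andP[f0 fxM].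
    by rewrite lee_fin mulr_ge0 ?enorm_ge0.
  by rewrite -EFinM lee_fin mul1r ler_wpM2r ?enorm_ge0.
- by move=> t _; rewrite lee_fin mul1r enorm_ge0.
apply/measurable_realfun.measurable_EFinP.
by apply: measurable_funTS; exact: measurable_realfun.continuous_measurable_fun.
Qed.

End Arc.

Lemma regular_arc_speed (gamma : R -> R * R) :
  regular_arc gamma -> continuous (fun t => enorm (velocity gamma t)).
Proof.
move=> [[_ c1] [_ c2] _] t.
apply: (@cvg_comp _ _ _ _ (@Num.sqrt R)); last exact: sqrt_continuous.
apply: cvgD.
- by apply: cvgM; exact: c1.
- by apply: cvgM; exact: c2.
Qed.

Lemma circle_velocity c (h t : R) :
  velocity (fun t => (c.1 + h * cos t, c.2 + h * sin t)) t =
  (- (h * sin t), h * cos t).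
Proof.
rewrite /velocity !derive1E /=; congr pair.
- have [_] := is_deriveD (is_derive_cst c.1 t 1) (is_deriveZ h (is_derive_cos t)).
  by rewrite add0r /GRing.scale/= mulrN => <-.
- have [_] := is_deriveD (is_derive_cst c.2 t 1) (is_deriveZ h (is_derive_sin t)).
  by rewrite add0r /GRing.scale/= => <-.
Qed.

Lemma circle_speed c (h t : R) : 0 <= h ->
  enorm (velocity (fun t => (c.1 + h * cos t, c.2 + h * sin t)) t) = h.
Proof.
move=> h0; rewrite circle_velocity /enorm/= sqrrN !exprMn -mulrDr.
by rewrite addrC cos2Dsin2 mulr1 sqrtr_sqr ger0_norm.
Qed.

Lemma circle_length c (h : R) : 0 <= h ->
  circle_integral c h (fun=> 1%R) = (2 * pi * h)%:E.
Proof.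
move=> h0; rewrite /circle_integral /arc_integral.
under eq_integral do rewrite circle_speed// mul1r.
rewrite integral_cst; last exact: measurable_itv.
have len : @lebesgue_measure R `[0, 2 * pi]%classic = (2 * pi)%:E.
  by rewrite lebesgue_measure_itv/= lte_fin mulr_gt0 ?pi_gt0// oppr0 adde0.
by rewrite muleC EFinM; congr (_ * _)%E; exact: len.
Qed.

Lemma circle_integral_le c (h : R) (f : R * R -> R) (M : R) : 0 <= h -> 0 <= M ->
  (forall x, enorm (x - c) = h -> 0 <= f x <= M) ->
  (circle_integral c h f <= (2 * pi * h * M)%:E)%E.
Proof.
move=> h0 M0 fM; rewrite [X in X%:E]mulrC EFinM -(circle_length c h0).
apply: arc_integral_le => // [t|t _].
  by under eq_fun do rewrite circle_speed//; exact: cvg_cst.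
apply: fM; rewrite /enorm /= ![_ + _ * _ - _]addrAC !subrr !add0r !exprMn -mulrDr.
by rewrite cos2Dsin2 mulr1 sqrtr_sqr ger0_norm.
Qed.

Lemma boundary_integral_le (K : mesh_element R) (f : R * R -> R) (M : R) :
  0 <= M -> (forall x, bdry K x -> 0 <= f x <= M) ->
  (boundary_integral K f <= (perimeter K * M)%:E)%E.
Proof.
move=> M0 fM; have [reg bdryE _] := element_boundary K.
have speed j := regular_arc_speed (reg j).
have per_fin : boundary_integral K (fun=> 1%R) \is a fin_num.
  by apply/sum_fin_numP => j _ _; exact: arc_integral1_fin.
rewrite mulrC EFinM /perimeter fineK// /boundary_integral ge0_sume_distrr; last first.
  by move=> j _; exact: arc_integral1_ge0.
apply: lee_sum => j _; apply: arc_integral_le => // t t01; apply: fM.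
by rewrite bdryE; exists j => //; exists t.
Qed.

Lemma perimeter_ge0 (K : mesh_element R) : 0 <= perimeter K.
Proof.
by apply: fine_ge0; apply: sume_ge0 => j _; exact: arc_integral1_ge0.
Qed.

End Integration.

(** * Lipschitz dependence of plane waves on their direction *)

Theorem lemma5p4 (R : realType) (kappa : R) (K : mesh_element R)
    (xK : R * R) (hK etamax : R) (z w : R[i]) :
  0 < kappa ->
  (K : set (R * R)) `<=` eball xK hK ->
  `|complex.Im z| <= etamax ->
  `|complex.Im w| <= etamax ->
  let D := Num.sqrt (cosh (2 * etamax)) in
  let E := expR (kappa * hK * sinh etamax) in
  let C_H1 := Num.sqrt (area K) * kappa * D * E *
    Num.sqrt (hK ^+ 2 + (1 + kappa * hK * D) ^+ 2) in
  let C_tr := Num.sqrt (2 * pi * hK * (kappa * D ^+ 2 * E ^+ 2 *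
    ((kappa * hK) ^+ 2 + (1 + kappa * hK * D) ^+ 2))) in
  let C_bd := Num.sqrt (perimeter K * (kappa * D ^+ 2 * E ^+ 2 *
    ((kappa * hK) ^+ 2 + (1 + kappa * hK * D) ^+ 2))) in
  let diff : R * R -> R[i] := fun x => psi kappa xK z x - psi kappa xK w x in
  [/\ (H1_norm K diff <= (C_H1 * cabs (z - w))%:E)%E,
      (trace_norm kappa xK hK diff <= (C_tr * cabs (z - w))%:E)%E &
      (boundary_norm kappa K diff <= (C_bd * cabs (z - w))%:E)%E].
Proof.
move=> k0 Kh z_eta w_eta D E C_H1 C_tr C_bd diff.
have [[x0 Kx0] oK _ _ _] := element_lipschitz K.
have h0 : 0 <= hK by apply: le_trans (ltW (Kh _ Kx0)); exact: enorm_ge0.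
pose N := cabs (z - w); pose S := 1 + kappa * hK * D.
have [D0 E0 N0] : [/\ 0 <= D, 0 <= E & 0 <= N].
  by rewrite sqrtr_ge0 expR_ge0 cabs_ge0.
have S0 : 0 <= S by rewrite addr_ge0 ?mulr_ge0// ltW.
(* Pointwise bounds of the difference of the waves and of its gradient. *)
pose Mv := kappa * hK * D * E * N; pose Mg := kappa * D * E * S * N.
have Mv0 : 0 <= Mv by rewrite !mulr_ge0// ltW.
have Mg0 : 0 <= Mg by rewrite !mulr_ge0// ltW.
have sqr_le (u v : R) : 0 <= u -> u <= v -> 0 <= u ^+ 2 <= v ^+ 2.
  by move=> u0 uv; rewrite sqr_ge0 lerXn2r ?nnegrE// (le_trans u0 uv).
have valP x : enorm (x - xK) <= hK -> 0 <= cabs (diff x) ^+ 2 <= Mv ^+ 2.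
  by move=> xh; apply: sqr_le (cabs_ge0 _) _; exact: (psiB_le (ltW k0) z_eta w_eta xh).
have gradP x : enorm (x - xK) <= hK -> cnorm2 (grad diff x) <= Mg.
  by move=> xh; exact: (grad_psiB_le (ltW k0) z_eta w_eta xh).
have grad2P x : enorm (x - xK) <= hK ->
    0 <= cnorm2 (grad diff x) ^+ 2 <= Mg ^+ 2.
  by move=> xh; apply: sqr_le (cnorm2_ge0 _) _; exact: gradP.
(* [B * N ^+ 2] bounds the integrand of both the trace and the boundary norm. *)
pose B := kappa * D ^+ 2 * E ^+ 2 * ((kappa * hK) ^+ 2 + S ^+ 2).
have B0 : 0 <= B by rewrite !mulr_ge0 ?addr_ge0 ?sqr_ge0// ltW.
have BE : kappa * Mv ^+ 2 + kappa^-1 * Mg ^+ 2 = B * N ^+ 2.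
  by rewrite /Mv /Mg /B; field; exact: lt0r_neq0.
have BP u v : 0 <= u <= Mv ^+ 2 -> 0 <= v <= Mg ^+ 2 ->
    0 <= kappa * u + kappa^-1 * v <= B * N ^+ 2.
  move=> /andP[u0 uM] /andP[v0 vM]; rewrite -BE.
  by rewrite addr_ge0 ?lerD ?mulr_ge0 ?ler_wpM2l ?invr_ge0// ltW.
split.
- have area0 : 0 <= area K by apply: fine_ge0; exact: measure_ge0.
  apply: sqrte_le_EFin; first by rewrite !mulr_ge0 ?sqrtr_ge0// ltW.
  have -> : (C_H1 * N) ^+ 2 = Mv ^+ 2 * area K + Mg ^+ 2 * area K.
    rewrite !exprMn (sqr_sqrtr area0) (sqr_sqrtr (addr_ge0 (sqr_ge0 hK) (sqr_ge0 S))).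
    by rewrite /Mv /Mg; ring.
  rewrite EFinD; apply: leeD; apply: (area_integral_le oK Kh); rewrite ?sqr_ge0//.
  + by move=> x /Kh/ltW; exact: valP.
  + by move=> x /Kh/ltW; exact: grad2P.
- have L0 : 0 <= 2 * pi * hK * B by rewrite mulr_ge0// mulr_ge0// mulr_ge0// pi_ge0.
  apply: sqrte_le_EFin; first by rewrite mulr_ge0 ?sqrtr_ge0.
  rewrite exprMn (sqr_sqrtr L0) -(mulrA _ B).
  apply: circle_integral_le => // [|x xh]; first by rewrite mulr_ge0 ?sqr_ge0.
  have xle : enorm (x - xK) <= hK by rewrite xh.
  apply: BP; first exact: valP.
  apply: sqr_le (cabs_ge0 _) _; apply: le_trans (gradP x xle).
  (* Cauchy-Schwarz against the normal. *)
  apply: le_trans (cabs_dotC _ _) _.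
  rewrite ler_piMr ?cnorm2_ge0// -xh.
  rewrite enormZ ger0_norm ?invr_ge0 ?enorm_ge0//.
  by have [->|r0] := eqVneq (enorm (x - xK)) 0; rewrite ?mulr0 ?mulVf.
- have L0 : 0 <= perimeter K * B by rewrite mulr_ge0 ?perimeter_ge0.
  apply: sqrte_le_EFin; first by rewrite mulr_ge0 ?sqrtr_ge0.
  rewrite exprMn (sqr_sqrtr L0) -(mulrA _ B).
  apply: boundary_integral_le => [|x [/(closure_eball Kh) xh _]].
    by rewrite mulr_ge0 ?sqr_ge0.
  by apply: BP; [exact: valP|exact: grad2P].
Qed.
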